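(* For $u,v,n\in\mathbb{N}$, let $C_3(u,v,n)$ be the number of partitions of $n$ into $u$ distinct parts congruent to $1$ modulo $3$ and $v$ distinct parts congruent to $2$ modulo $3$. Let $D_3(u,v,n)$ be the number of partitions $\lambda_1+\cdots+\lambda_s$ of $n$ into positive integers in two colours, ordinary and primed, such that only parts congruent to $\pm1\pmod 6$ may be primed, $1'$ is not a part, $u$ equals the number of ordinary parts congruent to $0$ or $1$ modulo $3$ plus twice the number of primed parts congruent to $5$ modulo $6$, $v$ equals the number of ordinary parts congruent to $0$ or $2$ modulo $3$ plus twice the number of primed parts congruent to $1$ modulo $6$, and for all $1\le i<s$: $$\lambda_i-\lambda_{i+1}\ge\begin{cases}4+\chi(\lambda_{i+1}) & \text{if }\lambda_i\equiv1,2,3,5\pmod 6\text{ and }\lambda_i\text{ is not primed},\\ 5+\chi(\lambda_{i+1}) & \text{if }\lambda_i\equiv 0,4\pmod 6,\\ 6+\chi(\lambda_{i+1}) & \text{if }\lambda_i\equiv1,5\pmod 6\text{ and }\lambda_i\text{ is primed},\end{cases}$$ where $\chi(\lambda_{i+1})=1$ if $\lambda_{i+1}$ is primed and $0$ otherwise. Then $C_3(u,v,n)=D_3(u,v,n)$ for all $u,v,n$. *)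

(* Defs.v *)
From mathcomp Require Import all_boot.
Set Implicit Arguments. Unset Strict Implicit. Unset Printing Implicit Defensive.

(* All lists of length at most k with entries from xs (each list appears
   exactly once when xs is duplicate-free). *)
Fixpoint seqs_upto (T : Type) (xs : seq T) (k : nat) : seq (seq T) :=
  match k with
  | 0 => [:: [::]]
  | k'.+1 => [::] :: [seq x :: l | x <- xs, l <- seqs_upto xs k']
  end.

Definition C3_part (u v n : nat) (s : seq nat) : bool :=
  [&& all (fun x => 0 < x) s,
      sorted (fun x y => y < x) s,
      sumn s == n,
      all (fun x => x %% 3 != 0) s,
      count (fun x => x %% 3 == 1) s == u &
      count (fun x => x %% 3 == 2) s == v].

(* every partition of n has at most n parts, each in [1, n] *)
Definition C3 (u v n : nat) : nat :=
  count (C3_part u v n) (seqs_upto (iota 1 n) n).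

(* A coloured part is (value, primed?). *)
Definition cpart := (nat * bool)%type.

Definition valid_cpart (x : cpart) : bool :=
  [&& 0 < x.1,
      x.2 ==> ((x.1 %% 6 == 1) || (x.1 %% 6 == 5)) &
      (x != (1, true))].

Definition gap (x : cpart) : nat :=
  if x.2 && ((x.1 %% 6 == 1) || (x.1 %% 6 == 5)) then 6
  else if (x.1 %% 6 == 0) || (x.1 %% 6 == 4) then 5
  else 4.

Definition chi (y : cpart) : nat := if y.2 then 1 else 0.

Definition diff_ok (x y : cpart) : bool := y.1 + (gap x + chi y) <= x.1.

Definition D3_u (s : seq cpart) : nat :=
  count (fun x => ~~ x.2 && ((x.1 %% 3 == 0) || (x.1 %% 3 == 1))) s
  + 2 * count (fun x => x.2 && (x.1 %% 6 == 5)) s.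

Definition D3_v (s : seq cpart) : nat :=
  count (fun x => ~~ x.2 && ((x.1 %% 3 == 0) || (x.1 %% 3 == 2))) s
  + 2 * count (fun x => x.2 && (x.1 %% 6 == 1)) s.

Definition D3_part (u v n : nat) (s : seq cpart) : bool :=
  [&& all valid_cpart s,
      sorted (fun x y : cpart => y.1 <= x.1) s,
      sumn (map fst s) == n,
      D3_u s == u,
      D3_v s == v &
      sorted diff_ok s].

Definition D3 (u v n : nat) : nat :=
  count (D3_part u v n)
    (seqs_upto [seq (i, b) | i <- iota 1 n, b <- [:: false; true]] n).

Example C3_ex : C3 1 1 3 = 1. Proof. by vm_compute. Qed.
Example D3_ex : D3 1 1 3 = 1. Proof. by vm_compute. Qed.

(* Main.v *)
Require Import Defs.
From mathcomp Require Import all_boot all_algebra.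
From mathcomp Require Import zify ring.
Set Implicit Arguments. Unset Strict Implicit. Unset Printing Implicit Defensive.
Import GRing.Theory Num.Theory.

(** Let [G_N(a, b)] be the polynomial counting (by [a^u b^v q^n]) the coloured
    partitions whose largest part [x] satisfies [x.1 + chi x <= N].  Removing the
    largest part gives recurrences in [N], depending on [N mod 6], from which
      [G_N(a, b) = (1 + a q) G_(N-2)(b q, a q^2)]   for [N = 0, 1, 3 mod 6], [N >= 1]
    follows by induction; applying it twice,
      [G_(6k+9)(a, b) = (1 + a q) (1 + b q^2) G_(6k+5)(a q^3, b q^3)].
    The product [prod_k (1 + a q^(3k+1)) (1 + b q^(3k+2))] attached to [C3]
    obeys the same functional equation.  Its coefficients at [(u, v, n)] form a
    recursion that, since [n] drops whenever [u + v > 0], has only one solution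
    with given values at [u = v = 0]. *)

(** * Bounded lists and duplicate-free counting *)

Lemma mem_seqs_upto (T : eqType) (xs : seq T) k s :
  (s \in seqs_upto xs k) = (size s <= k) && all (mem xs) s.
Proof.
elim: k s => [|k IHk] [|x s] //=.
rewrite inE /=; apply/allpairsP/and3P => [[[y t] /= [xs_y]]|[sz xs_x xs_s]].
  by rewrite IHk => /andP[sz xs_t] [-> ->].
by exists (x, s); rewrite IHk -ltnS sz xs_s; split.
Qed.

Lemma seqs_upto_uniq (T : eqType) (xs : seq T) k :
  uniq xs -> uniq (seqs_upto xs k).
Proof.
move=> Uxs; elim: k => [|k IHk] //=; rewrite allpairs_uniq //.
  by rewrite andbT; apply/allpairsP => -[[y t] [_ _]].
by move=> [x1 s1] [x2 s2] _ _ [-> ->].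
Qed.

(** Moves a count from [seqs_upto] to a recursive enumeration; the two lists need to agree only
    where the predicates hold. *)
Lemma eq_count_uniq (T : eqType) (p1 p2 : pred T) (s1 s2 : seq T) :
    uniq s1 -> uniq s2 ->
    (forall x, p1 x && (x \in s1) = p2 x && (x \in s2)) ->
  count p1 s1 = count p2 s2.
Proof.
move=> U1 U2 eq12; rewrite -!size_filter; apply/perm_size/uniq_perm.
- exact: filter_uniq.
- exact: filter_uniq.
by move=> x; rewrite !mem_filter.
Qed.

Lemma size_le_sumn (s : seq nat) : all (leq 1) s -> size s <= sumn s.
Proof. by elim: s => //= x s IHs /andP[x_gt0 /IHs]; lia. Qed.

Lemma le_sumn (s : seq nat) x : x \in s -> x <= sumn s.
Proof.
by elim: s => //= y s IHs; rewrite inE => /predU1P[->|/IHs]; lia.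
Qed.

(** * Joint distributions of three statistics and their generating functions *)

Section Statistics.
Variables (T : Type) (f g h : T -> nat).

Definition stat_count (l : seq T) (u v n : nat) : nat :=
  count (fun s => [&& f s == u, g s == v & h s == n]) l.

(** With [a], [b], [q] arbitrary ring elements, substitutions such as [a * q ^+ 3] for [a] are plain
    instantiations. *)
Definition stat_gf (R : comNzRingType) (a b q : R) (l : seq T) : R :=
  (\sum_(s <- l) a ^+ f s * b ^+ g s * q ^+ h s)%R.

Lemma stat_gf_cat (R : comNzRingType) (a b q : R) l1 l2 :
  (stat_gf a b q (l1 ++ l2) = stat_gf a b q l1 + stat_gf a b q l2)%R.
Proof. by rewrite /stat_gf big_cat. Qed.

Lemma stat_gf0 (R : comNzRingType) (a b q : R) :
  (stat_gf a b q [::] = 0)%R.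
Proof. by rewrite /stat_gf big_nil. Qed.

Lemma stat_gf_map (R : comNzRingType) (a b q : R) (k : T -> T) i j m l :
    (forall s, f (k s) = i + f s) -> (forall s, g (k s) = j + g s) ->
    (forall s, h (k s) = m + h s) ->
  (stat_gf a b q [seq k s | s <- l] =
    a ^+ i * b ^+ j * q ^+ m * stat_gf a b q l)%R.
Proof.
move=> fk gk hk; rewrite /stat_gf big_map mulr_sumr; apply: eq_bigr => s _.
by rewrite fk gk hk !exprD; ring.
Qed.

End Statistics.

(* The coefficient recursion expressed by
   [F (a, b) = (1 + a q) (1 + b q^2) F (a q^3, b q^3)]. *)
Definition shift_rec (F : nat -> nat -> nat -> nat) (u v n : nat) : nat :=
  let t e f := if [&& e <= u, f <= v & 3 * (u - e + (v - f)) + e + 2 * f <= n]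
    then F (u - e) (v - f) (n - (3 * (u - e + (v - f)) + e + 2 * f)) else 0 in
  t 0 0 + t 1 0 + (t 0 1 + t 1 1).

Lemma shift_rec_unique (F1 F2 : nat -> nat -> nat -> nat) :
    (forall n, F1 0 0 n = F2 0 0 n) ->
    (forall u v n, F1 u v n = shift_rec F1 u v n) ->
    (forall u v n, F2 u v n = shift_rec F2 u v n) ->
  forall u v n, F1 u v n = F2 u v n.
Proof.
move=> F00 F1E F2E u v n; elim/ltn_ind: n u v => n IHn u v.
have [/andP[/eqP-> /eqP->]|uv_neq0] := boolP ((u == 0) && (v == 0)) => //.
rewrite F1E F2E /shift_rec.
(* The amount subtracted from [n] is positive: as [u + v > 0], either [e + f > 0] or
   [u - e + (v - f) > 0]. *)
by congr ((_ + _) + (_ + _)); case: ifP => // ?; apply: IHn; lia.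
Qed.

(** * From generating-function identities to coefficient recursions *)

Section Coefficients.
Local Open Scope ring_scope.
Local Notation R := {poly {poly {poly int}}}.

(** The outermost variable plays [q], the middle one [b], the innermost [a]; hence the extraction
    order [n], [v], [u]. *)
Lemma coef_monomial3 (i j k u v n : nat) :
  (('X%:P%:P ^+ i * 'X%:P ^+ j * 'X ^+ k : R)`_n`_v)`_u
    = ([&& i == u, j == v & k == n] : nat)%:R.
Proof.
rewrite -!polyC_exp -polyCM coefCM coefXn.
case: (eqVneq n k) => _; last by rewrite mulr0 !coef0 !andbF.
rewrite mulr1 coefCM coefXn andbT.
case: (eqVneq v j) => _; last by rewrite mulr0 !coef0 !andbF.
by rewrite mulr1 coefXn andbT eq_sym.
Qed.

Lemma coef_stat_gf (T : Type) (f g h : T -> nat) (l : seq T) u v n :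
  ((stat_gf f g h 'X%:P%:P 'X%:P 'X l : R)`_n`_v)`_u
    = (stat_count f g h l u v n)%:R.
Proof.
rewrite /stat_gf !coef_sum /stat_count -sum1_count natr_sum [RHS]big_mkcond /=.
by apply: eq_bigr => s _; rewrite coef_monomial3; case: ifP.
Qed.

Lemma stat_count_shift (T : Type) (f g h : T -> nat) (l1 l2 : seq T) :
    (forall (S : comNzRingType) (a b q : S), stat_gf f g h a b q l1
       = (1 + a * q) * (1 + b * q ^+ 2)
         * stat_gf f g h (a * q ^+ 3) (b * q ^+ 3) q l2) ->
  forall u v n,
    stat_count f g h l1 u v n = shift_rec (stat_count f g h l2) u v n.
Proof.
move=> l12 u v n.
(* The term [a^e b^e' q^(e + 2e')] of the expanded product, together with the substitution in [a]
   and [b], only shifts the statistics of each element of [l2]. *)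
pose m e e' s := (h s + 3 * (f s + g s) + e + 2 * e')%N.
pose G (S : comNzRingType) (a b q : S) e e' :=
  stat_gf (fun s => f s + e)%N (fun s => g s + e')%N (m e e') a b q l2.
have gf12 (S : comNzRingType) (a b q : S) :
  stat_gf f g h a b q l1
    = G S a b q 0 0 + G S a b q 1 0 + (G S a b q 0 1 + G S a b q 1 1).
  rewrite l12 /G /stat_gf mulr_sumr -!big_split; apply: eq_bigr => s _ /=.
  by rewrite /m !exprD !muln0 !muln1 (exprMn _ a) (exprMn _ b) !(exprAC q 3); ring.
have := congr1 (fun p : R => p`_n`_v`_u) (gf12 R 'X%:P%:P 'X%:P 'X).
rewrite /= !coefD !coef_stat_gf -!natrD => /eqP; rewrite eqr_nat => /eqP->.
(* Solving the shifted equations for [f s], [g s], [h s] gives the arguments in [shift_rec]; when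
   its guard fails there is no solution. *)
rewrite /shift_rec; congr ((_ + _) + (_ + _))%N; rewrite /stat_count /m;
case: ifP => h1; by [apply: eq_count => s /=; lia
                    |rewrite -[RHS](count_pred0 l2); apply: eq_count => s /=; lia].
Qed.

End Coefficients.

(** * Enumeration of the partitions counted by [C3] *)

Definition C3_u (s : seq nat) : nat := count (fun x => x %% 3 == 1) s.
Definition C3_v (s : seq nat) : nat := count (fun x => x %% 3 == 2) s.

Fixpoint C3_enum (N : nat) : seq (seq nat) :=
  if N is M.+1 then
    C3_enum M ++ (if N %% 3 != 0 then [seq N :: s | s <- C3_enum M] else [::])
  else [:: [::]].

Definition C3_bounded (N : nat) (s : seq nat) : bool :=
  [&& all (fun x => 0 < x) s, sorted (fun x y => y < x) s,
      all (fun x => x %% 3 != 0) s & head 0 s <= N].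

Lemma C3_bounded_cons N x s :
  C3_bounded N (x :: s)
    = [&& 0 < x, x %% 3 != 0, x <= N & C3_bounded x.-1 s].
Proof.
rewrite /C3_bounded; case: s => [|y s] /=; first by lia.
by case: (path _ y s); case: (all _ s); case: (all _ s); rewrite ?andbF //; lia.
Qed.

Lemma mem_C3_enum N s : (s \in C3_enum N) = C3_bounded N s.
Proof.
elim: N s => [|M IHM] [|x s] //.
- by rewrite C3_bounded_cons inE; apply/esym/and4P => -[]; lia.
- by rewrite /= mem_cat IHM.
rewrite /= mem_cat IHM !C3_bounded_cons.
have -> : (x :: s \in if M.+1 %% 3 != 0 then [seq M.+1 :: i | i <- C3_enum M] else [::])
   = [&& x == M.+1, x %% 3 != 0 & C3_bounded M s].
  case: ifP => M3; last by rewrite in_nil; case: eqP => // ->; rewrite M3.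
  apply/mapP/and3P => [[t]|[/eqP-> _ sM]]; last by exists s; rewrite ?IHM.
  by rewrite IHM => tM [-> ->]; split.
have [->|x_neq] := eqVneq x M.+1; last by lia.
by rewrite /=; lia.
Qed.

Lemma C3_enum_uniq N : uniq (C3_enum N).
Proof.
elim: N => [|M IHM] //=; rewrite cat_uniq IHM /=.
case: ifP => // M3; rewrite map_inj_uniq ?IHM ?andbT; last by move=> ? ? [].
apply/hasP => -[t /mapP[s _ ->]]; rewrite /= mem_C3_enum C3_bounded_cons.
by rewrite ltnn !andbF.
Qed.

(** Parts of a partition of [n] are at most [n], so a bound [N >= n] excludes nothing. *)
Lemma C3_stat_count N u v n :
  n <= N -> stat_count C3_u C3_v sumn (C3_enum N) u v n = C3 u v n.
Proof.
move=> nN; apply: eq_count_uniq; first exact: C3_enum_uniq.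
  by apply: seqs_upto_uniq; apply: iota_uniq.
move=> s; rewrite mem_C3_enum mem_seqs_upto /C3_part /C3_bounded /C3_u /C3_v.
have [s_gt0|] := boolP (all (fun x => 0 < x) s); last by rewrite !andbF.
case: (sorted _ s); last by rewrite !andbF.
case: (all (fun x => x %% 3 != 0) s); last by rewrite !andbF.
have [sE|] := eqVneq (sumn s) n; last by rewrite !andbF.
have hs : head 0 s <= N by case: s sE {s_gt0} => //= x s; lia.
have -> : size s <= n by rewrite -sE size_le_sumn.
have -> : all (mem (iota 1 n)) s.
  apply/allP => x xs; rewrite inE mem_iota add1n ltnS (allP s_gt0) //=.
  by rewrite -sE le_sumn.
by rewrite hs !andbT.
Qed.

(** * Enumeration of the coloured partitions counted by [D3] *)

Definition head_size (s : seq cpart) : nat :=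
  if s is y :: _ then y.1 + chi y else 0.

(* A part [y] may follow [x] iff [y.1 + chi y <= x.1 - gap x], so bounding the
   first part by [y.1 + chi y <= N] makes the recursion in [N] close up. *)
Definition D3_bounded (N : nat) (s : seq cpart) : bool :=
  [&& all valid_cpart s, sorted diff_ok s & head_size s <= N].

(** A first part with [x.1 + chi x = N] is [N] ordinary or [N - 1] primed. The bound
    [M - (gap x).-1] is [N - gap x] in structurally decreasing form; truncation to 0 leaves just the
    empty tail. *)
Fixpoint D3_enum (N : nat) : seq (seq cpart) :=
  if N is M.+1 then
    D3_enum M
    ++ [seq (N, false) :: s | s <- D3_enum (M - (gap (N, false)).-1)]
    ++ (if valid_cpart (M, true)
        then [seq (M, true) :: s | s <- D3_enum (M - 6)] else [::])
  else [:: [::]].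

Lemma gap_gt0 x : 0 < gap x.
Proof. by rewrite /gap; case: ifP => // _; case: ifP. Qed.

Lemma gap_primed m : valid_cpart (m, true) -> gap (m, true) = 6.
Proof. by rewrite /valid_cpart /gap /= => /and3P[_ -> _]. Qed.

Lemma D3_bounded_cons N x s :
  D3_bounded N (x :: s)
    = [&& valid_cpart x, x.1 + chi x <= N & D3_bounded (x.1 - gap x) s].
Proof.
rewrite /D3_bounded; case: s => [|y s]; first by rewrite /= !andbT.
rewrite /=; case: (valid_cpart x) => //=.
have [vy|] := boolP (valid_cpart y); last by rewrite !andbF.
(* Positivity of [y.1] rules out a spurious solution when [x.1 - gap x] truncates to 0. *)
have y_gt0 : 0 < y.1 by case/and3P: vy.
rewrite /diff_ok; case: (path _ y s); case: (all _ s); rewrite ?andbF //=.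
by lia.
Qed.

Lemma mem_D3_enum N s : (s \in D3_enum N) = D3_bounded N s.
Proof.
elim/ltn_ind: N s => -[|M] IHN [|x s] //.
- rewrite D3_bounded_cons inE; apply/esym/and3P => -[/and3P[]]; lia.
- by rewrite /= mem_cat IHN.
rewrite /= !mem_cat IHN // !D3_bounded_cons.
have -> : (x :: s \in [seq (M.+1, false) :: i | i <- D3_enum (M - (gap (M.+1, false)).-1)])
   = (x == (M.+1, false)) && D3_bounded (x.1 - gap x) s.
  apply/mapP/andP => [[t]|[/eqP-> sM]].
    rewrite IHN ?ltnS ?leq_subr // => tM [-> ->]; split=> //=.
    by rewrite -subSS prednK ?gap_gt0 in tM.
  exists s => //; rewrite IHN ?ltnS ?leq_subr //.
  by rewrite -subSS prednK ?gap_gt0.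
have -> : (x :: s \in if valid_cpart (M, true)
       then [seq (M, true) :: i | i <- D3_enum (M - 6)] else [::])
   = [&& x == (M, true), valid_cpart x & D3_bounded (x.1 - gap x) s].
  case: ifP => vM; last first.
    by rewrite in_nil; case: eqP => // ->; rewrite vM.
  apply/mapP/and3P => [[t]|[/eqP-> _ sM]].
    by rewrite IHN ?ltnS ?leq_subr // => tM [-> ->]; rewrite vM gap_primed.
  by exists s; rewrite // IHN ?ltnS ?leq_subr // -(gap_primed vM).
have x_false : x = (M.+1, false) -> valid_cpart x.
  by move=> ->; rewrite /valid_cpart xpair_eqE andbF.
case: (D3_bounded _ s); last by rewrite !andbF.
rewrite !andbT; case: x x_false => m [] /= x_false.
  rewrite /chi /= !xpair_eqE andbF andbT /=.
  by case: (valid_cpart _); rewrite ?andbF //=; lia.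
rewrite /chi /= !xpair_eqE !andbF /= !andbT orbF addn0.
have [mM|] := eqVneq m M.+1; first by rewrite x_false ?mM // leqnn orbT.
by case: (valid_cpart _) => //=; lia.
Qed.

Lemma D3_enum_uniq N : uniq (D3_enum N).
Proof.
elim/ltn_ind: N => -[|M] IHN //=.
have inj x : injective (cons x : seq cpart -> seq cpart) by move=> ? ? [].
rewrite !cat_uniq IHN //= map_inj_uniq //= IHN ?ltnS ?leq_subr //=.
have fresh x l : M < x.1 + chi x -> ~~ has (mem (D3_enum M)) [seq x :: s | s <- l].
  move=> Mx; apply/hasP => -[t /mapP[s _ ->]].
  by rewrite /= mem_D3_enum D3_bounded_cons leqNgt Mx andbF.
rewrite has_cat negb_or fresh ?addn0 //=.
case: ifP => // vM; rewrite fresh ?addn1 //= map_inj_uniq ?IHN ?ltnS ?leq_subr //.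
by rewrite andbT; apply/hasP => -[t /mapP[s _ ->] /mapP[s' _ []]].
Qed.

Definition D3_sum (s : seq cpart) : nat := sumn (map fst s).

(** The strict bound makes room for a primed part [n], whose [head_size] is [n + 1]. *)
Lemma D3_stat_count N u v n :
  n < N -> stat_count D3_u D3_v D3_sum (D3_enum N) u v n = D3 u v n.
Proof.
move=> nN; apply: eq_count_uniq; first exact: D3_enum_uniq.
  apply: seqs_upto_uniq; apply: allpairs_uniq => //; first exact: iota_uniq.
  by move=> [? ?] [? ?] _ _ [-> ->].
move=> s; rewrite mem_D3_enum mem_seqs_upto /D3_part /D3_bounded /D3_sum.
have [s_valid|] := boolP (all valid_cpart s); last by rewrite !andbF.
have [s_diff|] := boolP (sorted diff_ok s); last by rewrite !andbF.
have -> : sorted (fun x y : cpart => y.1 <= x.1) s.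
  by apply: sub_sorted s_diff => x y; rewrite /diff_ok; lia.
have [sE|] := eqVneq (sumn (map fst s)) n; last by rewrite !andbF.
have hs : head_size s <= N.
  by case: s sE {s_valid s_diff} => //= -[x [] s] /=; rewrite /chi /=; lia.
have s_gt0 : all (leq 1) (map fst s).
  by apply/allP => _ /mapP[x /(allP s_valid) /and3P[x_gt0 _ _] ->].
have -> : size s <= n by rewrite -sE -(size_map fst) size_le_sumn.
have -> : all (mem [seq (i, b) | i <- iota 1 n, b <- [:: false; true]]) s.
  apply/allP => -[x c] xs; rewrite inE; apply/allpairsP; exists (x, c).
  have xs1 : x \in map fst s by apply/mapP; exists (x, c).
  split=> //=; last by rewrite !inE; case: (c).
  by rewrite mem_iota add1n ltnS (allP s_gt0 _ xs1) -sE le_sumn.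
by rewrite hs; case: (D3_u s == u); case: (D3_v s == v).
Qed.

(** * The initial values at [u = v = 0] *)

Lemma C3_00 n : C3 0 0 n = (n == 0).
Proof.
rewrite -(@C3_stat_count n) // /stat_count.
rewrite (@eq_count_uniq _ _ (fun s => sumn s == n) _ [:: [::]]) ?C3_enum_uniq //.
  by rewrite /= addn0 eq_sym.
case=> [|x s]; first by rewrite mem_C3_enum inE andbT.
rewrite mem_C3_enum C3_bounded_cons inE /= andbF /C3_u /C3_v /=; lia.
Qed.

(** Every valid coloured part contributes to [D3_u] or [D3_v], so only the empty partition
    remains. *)
Lemma D3_00 n : D3 0 0 n = (n == 0).
Proof.
rewrite -(@D3_stat_count n.+1) // /stat_count.
rewrite (@eq_count_uniq _ _ (fun s => D3_sum s == n) _ [:: [::]]) ?D3_enum_uniq //.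
  by rewrite /= addn0 eq_sym.
case=> [|x s]; first by rewrite mem_D3_enum inE andbT.
rewrite mem_D3_enum D3_bounded_cons inE /= andbF /D3_u /D3_v /=.
apply/negbTE/negP => /andP[/and3P[u0 v0 _] /andP[vx _]].
by move: vx u0 v0; rewrite /valid_cpart; case: x => m [] /=; lia.
Qed.

(** * The functional equation derived from the recurrences modulo 6 *)

Section ShiftIdentity.
Local Open Scope ring_scope.
Variables (R : comNzRingType) (q : R) (G : R -> R -> nat -> R).
Local Notation Q k := (q ^+ (k * 6)).

(** Small indices are separate: [1'] is excluded, and truncated tail bounds give the factor 1. *)
Hypothesis G1 : forall a b, G a b 1 = 1 + a * q.
Hypothesis G2 : forall a b, G a b 2 = G a b 1 + b * q ^+ 2.
Hypothesis G3 : forall a b, G a b 3 = G a b 2 + a * b * q ^+ 3.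
Hypothesis G4 : forall a b, G a b 4 = G a b 3 + a * q ^+ 4.
Hypothesis G5 : forall a b, G a b 5 = G a b 4 + b * q ^+ 5 * G a b 1.
Hypothesis G6 : forall a b,
  G a b 6 = G a b 5 + a * b * q ^+ 6 * G a b 1 + a ^+ 2 * q ^+ 5.
Hypothesis G7 : forall a b k, G a b (k * 6 + 7)
  = G a b (k * 6 + 6) + a * (Q k * q ^+ 7) * G a b (k * 6 + 3).
Hypothesis G8 : forall a b k, G a b (k * 6 + 8)
  = G a b (k * 6 + 7) + b * (Q k * q ^+ 8) * G a b (k * 6 + 4)
    + b ^+ 2 * (Q k * q ^+ 7) * G a b (k * 6 + 1).
Hypothesis G9 : forall a b k, G a b (k * 6 + 9)
  = G a b (k * 6 + 8) + a * b * (Q k * q ^+ 9) * G a b (k * 6 + 5).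
Hypothesis G10 : forall a b k, G a b (k * 6 + 10)
  = G a b (k * 6 + 9) + a * (Q k * q ^+ 10) * G a b (k * 6 + 5).
Hypothesis G11 : forall a b k, G a b (k * 6 + 11)
  = G a b (k * 6 + 10) + b * (Q k * q ^+ 11) * G a b (k * 6 + 7).
Hypothesis G12 : forall a b k, G a b (k * 6 + 12)
  = G a b (k * 6 + 11) + a * b * (Q k * q ^+ 12) * G a b (k * 6 + 7)
    + a ^+ 2 * (Q k * q ^+ 11) * G a b (k * 6 + 5).

Lemma index_shift k m : (k.+1 * 6 + m = k * 6 + (6 + m))%N.
Proof. lia. Qed.

(** Multiplying by [a q] turns the weight of [6k+4] into that of [(6k+5)'], and that of [6k+5] into
    that of [6k+6], with the same admissible tails. *)
Lemma gf_relation a b k :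
  (1 + a * q) * G a b (k * 6 + 5) = G a b (k * 6 + 6) + a * q * G a b (k * 6 + 3).
Proof.
case: k => [|k]; first by rewrite !mul0n !add0n G6 G5 G4; ring.
by rewrite !index_shift G12 G11 G10; ring.
Qed.

(** Residue 3 occurs twice because the induction step uses both [6k+3] and [6k+9]. *)
Lemma gf_shift_swap a b k : let H := G (b * q) (a * q ^+ 2) in
  [/\ G a b (k * 6 + 3) = (1 + a * q) * H (k * 6 + 1)%N,
      G a b (k * 6 + 6) = (1 + a * q) * H (k * 6 + 4)%N,
      G a b (k * 6 + 7) = (1 + a * q) * H (k * 6 + 5)%N
    & G a b (k * 6 + 9) = (1 + a * q) * H (k * 6 + 7)%N].
Proof.
move=> H; elim: k => [|k [P3 P6 P7 P9]].
  have := G7 a b 0; have := G8 a b 0; have := G9 a b 0.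
  have := G7 (b * q) (a * q ^+ 2) 0.
  rewrite /H !mul0n !add0n expr0 => -> -> -> ->.
  by rewrite !(G6, G5, G4, G3, G2, G1); split; ring.
have P12 : G a b (k * 6 + 12) = (1 + a * q) * H (k * 6 + 10)%N.
  (* Index [6k+5] has no swap identity, but it enters only through [(1 + a q) G_(6k+5)], which
     [gf_relation] rewrites with indices that have one. *)
  transitivity (G a b (k * 6 + 9) + a * (Q k * q ^+ 10) * G a b (k * 6 + 6)
     + a ^+ 2 * (Q k * q ^+ 11) * G a b (k * 6 + 3)
     + b * (Q k * q ^+ 11) * (1 + a * q) * G a b (k * 6 + 7)).
    rewrite G12 G11 G10.
    transitivity (G a b (k * 6 + 9)
      + a * (Q k * q ^+ 10) * ((1 + a * q) * G a b (k * 6 + 5))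
      + b * (Q k * q ^+ 11) * (1 + a * q) * G a b (k * 6 + 7)); first by ring.
    by rewrite gf_relation; ring.
  by rewrite P9 P6 P3 P7 /H G10 G9 G8; ring.
have P13 : G a b (k * 6 + 13) = (1 + a * q) * H (k * 6 + 11)%N.
  have := G7 a b k.+1; rewrite !index_shift => ->; rewrite /H G11 -/H P12.
  by rewrite mulSn exprD P9; ring.
(* [U] is what remains after cancelling the common factor [b q^(6k+14)]. *)
have U : (1 + a * q) * G a b (k * 6 + 11)
    = b * (Q k * q ^+ 11) * G a b (k * 6 + 7) + a * q * G a b (k * 6 + 9)
      + (1 + a * q) * H (k * 6 + 9)%N.
  transitivity (G a b (k * 6 + 9) * (1 + a * q)
     + a * (Q k * q ^+ 10) * ((1 + a * q) * G a b (k * 6 + 5))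
     + (1 + a * q) * b * (Q k * q ^+ 11) * G a b (k * 6 + 7)).
    by rewrite G11 G10; ring.
  by rewrite gf_relation P6 P3 P9 P7 /H G9 G8; ring.
(* Eliminating index [6k+10] from [P15] leaves [6k+11] only in the combination
   [(1 + a q) G_(6k+11)], where [U] applies. *)
have E10 : G a b (k * 6 + 10)
    = G a b (k * 6 + 11) - b * (Q k * q ^+ 11) * G a b (k * 6 + 7).
  by rewrite G11 addrK.
have P15 : G a b (k * 6 + 15) = (1 + a * q) * H (k * 6 + 13)%N.
  have := G9 a b k.+1; have := G8 a b k.+1.
  have := G7 (b * q) (a * q ^+ 2) k.+1; rewrite !index_shift -/H => -> -> ->.
  rewrite P13 E10 /H G12 -/H mulSn exprD.
  transitivity ((1 + a * q) * H (k * 6 + 11)%N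
    + b * (Q k * q ^+ 14) * ((1 + a * q) * G a b (k * 6 + 11))
    + b ^+ 2 * (Q k * q ^+ 13) * (1 - Q k * q ^+ 12) * G a b (k * 6 + 7)).
    by ring.
  by rewrite U P9 P7; ring.
by split; rewrite /H !index_shift.
Qed.

Lemma gf_shift_cube a b k : G a b (k * 6 + 9)
  = (1 + a * q) * (1 + b * q ^+ 2) * G (a * q ^+ 3) (b * q ^+ 3) (k * 6 + 5).
Proof.
have [_ _ _ ->] := gf_shift_swap a b k.
have [_ _ -> _] := gf_shift_swap (b * q) (a * q ^+ 2) k.
have -> : a * q ^+ 2 * q = a * q ^+ 3 by ring.
have -> : b * q * q ^+ 2 = b * q ^+ 3 by ring.
by ring.
Qed.
End ShiftIdentity.

(** * Recurrences for the generating functions of both enumerations *)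

Section GeneratingFunctions.
Local Open Scope ring_scope.
Variable R : comNzRingType.
Implicit Types a b q : R.

Definition C3_gf q a b N := stat_gf C3_u C3_v sumn a b q (C3_enum N).

Lemma C3_gf_step q a b k : C3_gf q a b (k.+1 * 3)
  = C3_gf q a b (k * 3) * (1 + a * q ^+ (k * 3 + 1)) * (1 + b * q ^+ (k * 3 + 2)).
Proof.
rewrite /C3_gf mulSn /= addSn.
have -> : ((k * 3).+3 %% 3 != 0 = false)%N by lia.
have -> : ((k * 3).+2 %% 3 != 0)%N by lia.
have -> : ((k * 3).+1 %% 3 != 0)%N by lia.
rewrite !stat_gf_cat stat_gf0 addr0.
rewrite !(@stat_gf_map _ _ _ _ _ a b q (cons (k * 3).+2) 0 1 (k * 3).+2);
  try by move=> s; rewrite /C3_u /C3_v /=; lia.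
rewrite !(@stat_gf_map _ _ _ _ _ a b q (cons (k * 3).+1) 1 0 (k * 3).+1);
  try by move=> s; rewrite /C3_u /C3_v /=; lia.
by rewrite !stat_gf_cat
  !(@stat_gf_map _ _ _ _ _ a b q (cons (k * 3).+1) 1 0 (k * 3).+1)
  ?addn1 ?addn2; [ring|move=> s; rewrite /C3_u /C3_v /=; lia ..].
Qed.

(** The substitution moves each pair of factors of the finite product up by one index, leaving the
    pair for the parts 1 and 2 in front. *)
Lemma C3_gf_shift q a b k : C3_gf q a b (k.+1 * 3)
  = (1 + a * q) * (1 + b * q ^+ 2) * C3_gf q (a * q ^+ 3) (b * q ^+ 3) (k * 3).
Proof.
elim: k => [|k IHk]; rewrite C3_gf_step; first by rewrite /C3_gf /stat_gf !big_seq1 /=; ring.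
by rewrite IHk C3_gf_step mulSn !exprD; ring.
Qed.

Definition D3_gf q a b N := stat_gf D3_u D3_v D3_sum a b q (D3_enum N).

Definition cpart_gf q a b x :=
  a ^+ D3_u [:: x] * b ^+ D3_v [:: x] * q ^+ x.1.

Lemma D3_gf_step q a b M : D3_gf q a b M.+1
  = D3_gf q a b M
    + cpart_gf q a b (M.+1, false) * D3_gf q a b (M - (gap (M.+1, false)).-1)
    + (if valid_cpart (M, true)
       then cpart_gf q a b (M, true) * D3_gf q a b (M - 6) else 0).
Proof.
rewrite /D3_gf [D3_enum M.+1]/= !stat_gf_cat addrA.
have cons_gf x l : stat_gf D3_u D3_v D3_sum a b q [seq x :: s | s <- l]
    = cpart_gf q a b x * stat_gf D3_u D3_v D3_sum a b q l.
  by apply: stat_gf_map => s; rewrite /D3_u /D3_v /D3_sum /=; lia.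
by case: ifP => _; rewrite !cons_gf ?stat_gf0.
Qed.

Lemma D3_gf_ordinary q a b M N i j m :
    D3_u [:: (M.+1, false)] = i -> D3_v [:: (M.+1, false)] = j ->
    gap (M.+1, false) = m -> valid_cpart (M, true) = false ->
    (M - m.-1 = N)%N ->
  D3_gf q a b M.+1
    = D3_gf q a b M + a ^+ i * b ^+ j * q ^+ M.+1 * D3_gf q a b N.
Proof. by move=> ui vj gm nM MN; rewrite D3_gf_step nM addr0 /cpart_gf ui vj gm MN. Qed.

Lemma D3_gf_primed q a b M N N' i j i' j' m :
    D3_u [:: (M.+1, false)] = i -> D3_v [:: (M.+1, false)] = j ->
    gap (M.+1, false) = m -> valid_cpart (M, true) ->
    D3_u [:: (M, true)] = i' -> D3_v [:: (M, true)] = j' ->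
    (M - m.-1 = N)%N -> (M - 6 = N')%N ->
  D3_gf q a b M.+1
    = D3_gf q a b M + a ^+ i * b ^+ j * q ^+ M.+1 * D3_gf q a b N
      + a ^+ i' * b ^+ j' * q ^+ M * D3_gf q a b N'.
Proof.
by move=> ui vj gm nM ui' vj' MN MN';
  rewrite D3_gf_step nM /cpart_gf ui vj gm ui' vj' MN MN'.
Qed.

Local Ltac residues :=
  rewrite /gap /D3_u /D3_v /valid_cpart ?xpair_eqE /=;
  by [lia | case: ifP; lia].

Lemma D3_gf_shift q a b k : D3_gf q a b (k * 6 + 9)
  = (1 + a * q) * (1 + b * q ^+ 2)
    * D3_gf q (a * q ^+ 3) (b * q ^+ 3) (k * 6 + 5).
Proof.
apply: (@gf_shift_cube R q (D3_gf q)) => {a b k} a b.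
(* Numeric arguments: [M], the tail bounds, the exponents of [a] and [b] for each possible first
   part, then the gap of the ordinary part. *)
- by rewrite (@D3_gf_ordinary q a b 0 0 1 0 4) //= /D3_gf /stat_gf big_seq1; ring.
(* The ordinary recurrence applies at [M = 1] since [1'] is not a part. *)
- by rewrite (@D3_gf_ordinary q a b 1 0 0 1 4) // {2}/D3_gf /stat_gf big_seq1; ring.
- by rewrite (@D3_gf_ordinary q a b 2 0 1 1 4) // {2}/D3_gf /stat_gf big_seq1; ring.
- by rewrite (@D3_gf_ordinary q a b 3 0 1 0 5) // {2}/D3_gf /stat_gf big_seq1; ring.
- by rewrite (@D3_gf_ordinary q a b 4 1 0 1 4) //; ring.
- by rewrite (@D3_gf_primed q a b 5 1 0 1 1 2 0 5) // {3}/D3_gf /stat_gf big_seq1; ring.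
- move=> k; rewrite [in LHS]addnS.
  rewrite (@D3_gf_ordinary q a b _ (k * 6 + 3) 1 0 4); [|residues ..].
  by rewrite -addnS exprD; ring.
- move=> k; rewrite [in LHS]addnS.
  rewrite (@D3_gf_primed q a b _ (k * 6 + 4) (k * 6 + 1) 0 1 0 2 4); [|residues ..].
  by rewrite -addnS !exprD; ring.
- move=> k; rewrite [in LHS]addnS.
  rewrite (@D3_gf_ordinary q a b _ (k * 6 + 5) 1 1 4); [|residues ..].
  by rewrite -addnS exprD; ring.
- move=> k; rewrite [in LHS]addnS.
  rewrite (@D3_gf_ordinary q a b _ (k * 6 + 5) 1 0 5); [|residues ..].
  by rewrite -addnS exprD; ring.
- move=> k; rewrite [in LHS]addnS.
  rewrite (@D3_gf_ordinary q a b _ (k * 6 + 7) 0 1 4); [|residues ..].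
  by rewrite -addnS exprD; ring.
- move=> k; rewrite [in LHS]addnS.
  rewrite (@D3_gf_primed q a b _ (k * 6 + 7) (k * 6 + 5) 1 1 2 0 5); [|residues ..].
  by rewrite -addnS !exprD; ring.
Qed.

End GeneratingFunctions.

(** * The common recursion and the conclusion *)

Lemma C3_rec u v n : C3 u v n = shift_rec C3 u v n.
Proof.
(* Both truncation levels, [3(n+1)] and [3n], are at least [n], so the counts involved are exact. *)
rewrite -(@C3_stat_count (n.+1 * 3)) ?(@stat_count_shift _ _ _ _ _ (C3_enum (n * 3))); try lia.
  by rewrite /shift_rec !C3_stat_count //; lia.
by move=> S a b q; apply: C3_gf_shift.
Qed.

Lemma D3_rec u v n : D3 u v n = shift_rec D3 u v n.
Proof.
rewrite -(@D3_stat_count (n * 6 + 9)) ?(@stat_count_shift _ _ _ _ _ (D3_enum (n * 6 + 5))); try lia.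
  by rewrite /shift_rec !D3_stat_count //; lia.
by move=> S a b q; apply: D3_gf_shift.
Qed.

Theorem theorem2p4 (u v n : nat) : C3 u v n = D3 u v n.
Proof.
apply: shift_rec_unique u v n => [n||]; [|exact: C3_rec|exact: D3_rec].
by rewrite C3_00 D3_00.
Qed.
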